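(* Let $R$ be a commutative ring, $\ell\in\mathbb{N}$, and let $((J_0,U_0),\ldots,(J_\ell,U_\ell))$ be a list of $\ell+1$ pairs of finite subsets of $R$. The following properties are equivalent. 1. There exist $j_i\in\langle J_i\rangle$ and $u_i\in\mathcal{M}(U_i)$ $(i=0,\ldots,\ell)$ such that $$u_0\cdot(u_1\cdot(\cdots(u_\ell+j_\ell)+\cdots)+j_1)+j_0=0.$$ 2. There exist $L_1,\ldots,L_\ell\in\mathrm{Zar}(R)$ such that in $\mathrm{Zar}(R)$: $$\begin{array}{rcl} L_1,\ \widetilde{U_0}&\vdash&\widetilde{J_0}\\ L_2,\ \widetilde{U_1}&\vdash&\widetilde{J_1},\ L_1\\ &\vdots&\\ L_\ell,\ \widetilde{U_{\ell-1}}&\vdash&\widetilde{J_{\ell-1}},\ L_{\ell-1}\\ \widetilde{U_\ell}&\vdash&\widetilde{J_\ell},\ L_\ell \end{array}$$ 3. There exist $x_1,\ldots,x_\ell\in R$ such that, for the entailment relation $\vdash$ on $R$ defined in the context: $$\begin{array}{rcl} x_1,\ U_0&\vdash&J_0\\ x_2,\ U_1&\vdash&J_1,\ x_1\\ &\vdots&\\ x_\ell,\ U_{\ell-1}&\vdash&J_{\ell-1},\ x_{\ell-1}\\ U_\ell&\vdash&J_\ell,\ x_\ell \end{array}$$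
   Context: $\langle J\rangle$ is the ideal of $R$ generated by $J$; $\mathcal{M}(U)$ is the multiplicative monoid generated by $U$ (containing $1$). The Zariski lattice $\mathrm{Zar}(R)$ is the distributive lattice whose elements are the radicals of finitely generated ideals of $R$, ordered by inclusion, with $\sqrt{I_1}\wedge\sqrt{I_2}=\sqrt{I_1I_2}$ and $\sqrt{I_1}\vee\sqrt{I_2}=\sqrt{I_1+I_2}$. For $a\in R$, $\widetilde a=\sqrt{\langle a\rangle}$, and for $S\subseteq R$, $\widetilde S=\{\widetilde s: s\in S\}$. In a distributive lattice, for finite subsets $A,B$, $A\vdash B$ means $\bigwedge A\le\bigvee B$ (with $\bigwedge\emptyset=1$, $\bigvee\emptyset=0$). Commas denote union and an element stands for its singleton. An entailment relation on a set $S$ is a relation $\vdash$ between finite subsets of $S$ which is reflexive ($a\vdash a$), monotone (if $A\vdash B$, $A\subseteq A'$, $B\subseteq B'$ then $A'\vdash B'$) and transitive (if $A,x\vdash B$ and $A\vdash B,x$ then $A\vdash B$). The entailment relation on $R$ used in item 3 is the least entailment relation on $R$ such that, for all $x,y\in R$: $0\vdash\emptyset$; $\emptyset\vdash 1$; $x,y\vdash xy$; $xy\vdash x$; $x+y\vdash x,y$. For $\ell=0$ item 2 reads $\widetilde{U_0}\vdash\widetilde{J_0}$, item 3 reads $U_0\vdash J_0$, and item 1 reads $u_0+j_0=0$. *)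

(* Defs.v *)
From HB Require Import structures.
From mathcomp Require Import all_boot all_order all_algebra finmap.
From mathcomp Require Import boolp classical_sets.

Set Implicit Arguments.
Unset Strict Implicit.
Unset Printing Implicit Defensive.

Import Order.TTheory GRing.Theory.

Local Open Scope fset_scope.
Local Open Scope classical_set_scope.
Local Open Scope ring_scope.

Section Ideals.
Variable R : comPzRingType.
Implicit Types (I J : set R) (x y : R).

Definition is_ideal I : Prop :=
  [/\ I 0, forall x y, I x -> I y -> I (x + y) & forall a x, I x -> I (a * x)].

Definition ideal_gen (G : set R) : set R := smallest is_ideal G.

Definition is_submonoid (S : set R) : Prop :=
  S 1 /\ forall x y, S x -> S y -> S (x * y).

Definition monoid_gen (G : set R) : set R := smallest is_submonoid G.

Definition radical I : set R := [set x | exists n : nat, I (x ^+ n)].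

Definition ideal_add I J : set R := [set x + y | x in I & y in J].

Definition ideal_mul I J : set R := ideal_gen [set x * y | x in I & y in J].

Lemma ideal_gen_is_ideal (G : set R) : is_ideal (ideal_gen G).
Proof.
split=> [|x y Gx Gy|a x Gx] I IG; have [[I0 ID IM] GI] := IG => //.
  by apply: ID; [exact: Gx|exact: Gy].
by apply: IM; exact: Gx.
Qed.

Lemma ideal_sum I (T : Type) (r : seq T) (P : pred T) (F : T -> R) :
  is_ideal I -> (forall i, P i -> I (F i)) -> I (\sum_(i <- r | P i) F i).
Proof. by move=> [I0 ID _] IF; elim/big_ind: _. Qed.

Lemma ideal_expr_ge I x m n :
  is_ideal I -> (m <= n)%N -> I (x ^+ m) -> I (x ^+ n).
Proof. by move=> [_ _ IM] /subnK<- Ix; rewrite exprD; apply: IM. Qed.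

Lemma radical_is_ideal I : is_ideal I -> is_ideal (radical I).
Proof.
move=> Iid; have [I0 ID IM] := Iid; split=> [|x y [m Ixm] [n Iyn]|a x [n Ixn]].
- by exists 1%N; rewrite expr1.
- exists (m + n)%N; rewrite exprDn; apply: ideal_sum => // i _.
  rewrite -mulr_natl; apply: (IM).
  have [lemi|ltim] := leqP n i; first exact/IM/(ideal_expr_ge Iid lemi).
  rewrite mulrC; apply/IM/(ideal_expr_ge Iid _ Ixm).
  by rewrite -addnBA ?leq_addr // ltnW.
- by exists n; rewrite exprMn; apply: IM.
Qed.

Lemma sub_radical I : I `<=` radical I.
Proof. by move=> x Ix; exists 1%N; rewrite expr1. Qed.

Lemma radical_sub I J : I `<=` radical J -> radical I `<=` radical J.
Proof. by move=> IJ x [n /IJ[m Jx]]; exists (n * m)%N; rewrite exprM. Qed.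

Lemma ideal_gen_sub (G : set R) I :
  is_ideal I -> G `<=` I -> ideal_gen G `<=` I.
Proof. exact: smallest_sub. Qed.

Lemma ideal_add_is_ideal I J :
  is_ideal I -> is_ideal J -> is_ideal (ideal_add I J).
Proof.
move=> [I0 ID IM] [J0 JD JM]; split.
- by exists 0 => //; exists 0; rewrite ?addr0.
- move=> _ _ [x1 Ix1 [y1 Jy1 <-]] [x2 Ix2 [y2 Jy2 <-]].
  by rewrite addrACA; exists (x1 + x2); [exact: ID|exists (y1 + y2); [exact: JD|]].
- move=> a _ [x Ix [y Jy <-]]; rewrite mulrDr.
  by exists (a * x); [exact: IM|exists (a * y); [exact: JM|]].
Qed.

Lemma radical_addr I J : is_ideal I -> is_ideal J ->
  radical (ideal_add (radical I) (radical J)) = radical (ideal_add I J).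
Proof.
move=> Iid Jid; have IJid := ideal_add_is_ideal Iid Jid.
have [_ rD _] := radical_is_ideal IJid.
have [[I0 _ _] [J0 _ _]] := (Iid, Jid).
apply/seteqP; split; apply: radical_sub.
  move=> _ [x [m Ix] [y [n Jy] <-]]; apply: rD.
    by exists m, (x ^+ m) => //; exists 0; rewrite ?addr0.
  by exists n, 0 => //; exists (y ^+ n); rewrite ?add0r.
move=> _ [x Ix [y Jy <-]]; apply: sub_radical.
by exists x; [exact: sub_radical|exists y; [exact: sub_radical|]].
Qed.

Lemma radical_mulr I J : is_ideal I -> is_ideal J ->
  radical (ideal_mul (radical I) (radical J)) = radical (ideal_mul I J).
Proof.
move=> Iid Jid; apply/seteqP; split; apply: radical_sub.
  apply: ideal_gen_sub; first exact/radical_is_ideal/ideal_gen_is_ideal.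
  move=> _ [x [m Ix] [y [n Jy] <-]]; exists (m + n)%N; apply: sub_gen_smallest.
  exists (x ^+ (m + n)); first exact: ideal_expr_ge (leq_addr _ _) Ix.
  exists (y ^+ (m + n)); first exact: ideal_expr_ge (leq_addl _ _) Jy.
  by rewrite exprMn.
apply: ideal_gen_sub; first exact/radical_is_ideal/ideal_gen_is_ideal.
move=> _ [x Ix [y Jy <-]]; apply: sub_radical; apply: sub_gen_smallest.
by exists x; [exact: sub_radical|exists y; [exact: sub_radical|]].
Qed.

Lemma radical_mulI I J : is_ideal I -> is_ideal J ->
  radical (ideal_mul I J) = radical I `&` radical J.
Proof.
move=> Iid Jid; have [[_ _ IM] [_ _ JM]] := (Iid, Jid).
apply/seteqP; split=> [|x [[m Ix] [n Jx]]].
  by rewrite subsetI; split; apply: radical_sub; apply: subset_trans (@sub_radical _);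
    apply: ideal_gen_sub => // _ [x Ix [y Jy <-]]; [rewrite mulrC; exact: IM|exact: JM].
exists (m + n)%N; apply: sub_gen_smallest.
by exists (x ^+ m) => //; exists (x ^+ n) => //; rewrite exprD.
Qed.

Lemma ideal_add_gen (A B : {fset R}) :
  ideal_add (ideal_gen [set` A]) (ideal_gen [set` B]) =
  ideal_gen [set` (A `|` B)%fset].
Proof.
have [[gA gB] gAB] := (ideal_gen_is_ideal [set` A], ideal_gen_is_ideal [set` B],
  ideal_gen_is_ideal [set` (A `|` B)%fset]).
have [[[A0 _ _] [B0 _ _]] [_ D _]] := (gA, gB, gAB).
apply/seteqP; split.
  have sA : ideal_gen [set` A] `<=` ideal_gen [set` (A `|` B)%fset].
    by apply: ideal_gen_sub => // x Ax; apply: sub_gen_smallest;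
      rewrite /= in_fsetU [x \in A]Ax.
  have sB : ideal_gen [set` B] `<=` ideal_gen [set` (A `|` B)%fset].
    by apply: ideal_gen_sub => // x Bx; apply: sub_gen_smallest;
      rewrite /= in_fsetU [x \in B]Bx orbT.
  by move=> _ [x /sA Ax [y /sB By <-]]; apply: D.
apply: ideal_gen_sub; first exact: ideal_add_is_ideal.
move=> x /=; rewrite in_fsetU => /orP[Ax|Bx].
  by exists x; [exact: sub_gen_smallest|exists 0; rewrite ?addr0].
by exists 0 => //; exists x; [exact: sub_gen_smallest|rewrite add0r].
Qed.

Lemma ideal_mul_gen (A B : {fset R}) :
  ideal_mul (ideal_gen [set` A]) (ideal_gen [set` B]) =
  ideal_gen [set` [fset a * b | a in A, b in B]%fset].
Proof.
set AB := [set` [fset a * b | a in A, b in B]%fset].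
have gAB := ideal_gen_is_ideal AB; have [AB0 ABD ABM] := gAB.
apply/seteqP; split; last first.
  apply: ideal_gen_sub; first exact: ideal_gen_is_ideal.
  move=> _ /imfset2P[a aA [b bB ->]]; apply: sub_gen_smallest.
  by exists a; [exact: sub_gen_smallest|exists b; [exact: sub_gen_smallest|]].
apply: ideal_gen_sub => //.
move=> _ [x Ax [y By <-]].
pose K1 := [set z | forall b, b \in B -> ideal_gen AB (z * b)].
have xK1 : K1 x.
  apply: (ideal_gen_sub _ _ Ax).
    split=> [b _|u v Ku Kv b bB|c u Ku b bB]; first by rewrite mul0r.
      by rewrite mulrDl; exact: (ABD _ _ (Ku _ bB) (Kv _ bB)).
    by rewrite -mulrA; exact: (ABM _ _ (Ku _ bB)).
  by move=> a aA b bB; apply: sub_gen_smallest; apply/imfset2P; exists a => //; exists b.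
have : [set z | ideal_gen AB (x * z)] y; last by [].
apply: (ideal_gen_sub _ _ By).
  split=> [|u v Ku Kv|c u Ku] /=; first by rewrite mulr0.
    by rewrite mulrDr; exact: (ABD _ _ Ku Kv).
  by rewrite mulrCA; exact: (ABM _ _ Ku).
by move=> b bB; apply: xK1.
Qed.

End Ideals.

Section Zariski.
Variable R : comPzRingType.

Record Zar := MkZar {
  zar_set :> set R;
  zar_fg : exists J : {fset R}, zar_set = radical (ideal_gen [set` J]) }.

Lemma zar_inj : injective zar_set.
Proof.
move=> [I fI] [J fJ] /= eIJ; rewrite eIJ in fI *.
by rewrite (Prop_irrelevance fI fJ).
Qed.

HB.instance Definition _ := gen_eqMixin Zar.
HB.instance Definition _ := gen_choiceMixin Zar.

Definition zar_of (J : {fset R}) : Zar :=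
  MkZar (ex_intro _ J (erefl (radical (ideal_gen [set` J])))).

Definition zar_tilde (a : R) : Zar := zar_of [fset a].

Definition zar_le (L M : Zar) : bool := `[< zar_set L `<=` zar_set M >].

Fact zar_meet_fg (L M : Zar) : exists J : {fset R},
  radical (ideal_mul L M) = radical (ideal_gen [set` J]).
Proof.
have [[A ->] [B ->]] := (zar_fg L, zar_fg M).
exists [fset a * b | a in A, b in B]%fset.
by rewrite radical_mulr ?ideal_mul_gen //; apply: ideal_gen_is_ideal.
Qed.

Fact zar_join_fg (L M : Zar) : exists J : {fset R},
  radical (ideal_add L M) = radical (ideal_gen [set` J]).
Proof.
have [[A ->] [B ->]] := (zar_fg L, zar_fg M).
exists (A `|` B)%fset.
by rewrite radical_addr ?ideal_add_gen //; apply: ideal_gen_is_ideal.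
Qed.

(* The operations are defined from the radical ideals L and M themselves;
   zar_meet_of and zar_join_of below show independence of the chosen finitely
   generated ideals. *)
Definition zar_meet (L M : Zar) : Zar := MkZar (zar_meet_fg L M).
Definition zar_join (L M : Zar) : Zar := MkZar (zar_join_fg L M).

Lemma zar_is_ideal (L : Zar) : is_ideal L.
Proof.
by have [J ->] := zar_fg L; apply/radical_is_ideal/ideal_gen_is_ideal.
Qed.

Lemma zar_radical (L : Zar) : radical L = L.
Proof.
apply/seteqP; split; last exact: sub_radical.
by have [J ->] := zar_fg L; apply: radical_sub.
Qed.

Lemma zar_meet_setI (L M : Zar) : zar_meet L M = L `&` M :> set R.
Proof. by rewrite /= radical_mulI ?zar_radical //; apply: zar_is_ideal. Qed.

Fact zar_le_refl : reflexive zar_le.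
Proof. by move=> L; apply/asboolP. Qed.

Fact zar_le_anti : antisymmetric zar_le.
Proof.
by move=> L M /andP[/asboolP LM /asboolP ML]; apply/zar_inj/seteqP.
Qed.

Fact zar_le_trans : transitive zar_le.
Proof.
move=> M L N /asboolP LM /asboolP MN; apply/asboolP; exact: subset_trans MN.
Qed.

Fact zar_display : Order.disp_t. Proof. exact: Order.Disp tt tt. Qed.

HB.instance Definition _ := Order.Le_isPOrder.Build zar_display Zar
  zar_le_refl zar_le_anti zar_le_trans.

Fact zar_meetP (L M N : Zar) :
  (L <= zar_meet M N)%O = (L <= M)%O && (L <= N)%O.
Proof.
apply/idP/andP => [/asboolP|[/asboolP LM /asboolP LN]].
  by rewrite zar_meet_setI subsetI => -[LM LN]; split; apply/asboolP.
by apply/asboolP; rewrite zar_meet_setI subsetI.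
Qed.

Fact zar_joinP (L M N : Zar) :
  (zar_join L M <= N)%O = (L <= N)%O && (M <= N)%O.
Proof.
have [[L0 _ _] [M0 _ _]] := (zar_is_ideal L, zar_is_ideal M).
have [_ ND _] := zar_is_ideal N.
apply/idP/andP => [/asboolP LMN|[/asboolP LN /asboolP MN]].
  by split; apply/asboolP => x xL; apply/LMN/sub_radical;
    [exists x => //; exists 0|exists 0 => //; exists x]; rewrite ?addr0 ?add0r.
apply/asboolP; rewrite -[zar_set N]zar_radical; apply: radical_sub.
move=> _ [x Lx [y My <-]]; apply: sub_radical.
by apply: ND; [exact: LN|exact: MN].
Qed.

HB.instance Definition _ := Order.POrder_MeetJoin_isLattice.Build
  zar_display Zar zar_meetP zar_joinP.

Fact zar_meetUl : @left_distributive Zar Zar Order.meet Order.join.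
Proof.
move=> L M N; apply/le_anti/andP; split; last first.
  by rewrite leUx !lexI !leIr !andbT !(le_trans (leIl _ _)) ?leUl ?leUr.
apply/asboolP; rewrite [zar_set (_ `&` _)%O]zar_meet_setI.
have [_ _ NM] := zar_is_ideal N.
move=> x [[n [y Ly [z Mz yz]]] Nx]; exists n.+1.
rewrite exprS mulrC -yz mulrDl; exists (y * x).
  by rewrite [X in X _]zar_meet_setI; split; [rewrite mulrC|];
    [have [_ _] := zar_is_ideal L; apply|exact: NM].
exists (z * x) => //; rewrite [X in X _]zar_meet_setI; split; last exact: NM.
by rewrite mulrC; have [_ _] := zar_is_ideal M; apply.
Qed.

HB.instance Definition _ := Order.Lattice_Meet_isDistrLattice.Build
  zar_display Zar zar_meetUl.

Fact zar_le0 (L : Zar) : (zar_of fset0 <= L)%O.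
Proof.
apply/asboolP; rewrite -[zar_set L]zar_radical; apply: radical_sub.
by apply: subset_trans (@sub_radical _ _); apply: ideal_gen_sub => //; apply: zar_is_ideal.
Qed.

Fact zar_le1 (L : Zar) : (L <= zar_of [fset 1])%O.
Proof.
have [_ _ M] := ideal_gen_is_ideal [set` [fset (1 : R)]].
apply/asboolP=> x _; exists 1%N; rewrite expr1 -[x]mulr1; apply: M.
by apply: sub_gen_smallest; rewrite /= in_fset1.
Qed.

HB.instance Definition _ := Order.hasBottom.Build zar_display Zar zar_le0.
HB.instance Definition _ := Order.hasTop.Build zar_display Zar zar_le1.

Lemma zar_meet_of (A B : {fset R}) : (zar_of A `&` zar_of B)%O =
  radical (ideal_mul (ideal_gen [set` A]) (ideal_gen [set` B])) :> set R.
Proof. by rewrite [LHS]radical_mulr //; apply: ideal_gen_is_ideal. Qed.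

Lemma zar_join_of (A B : {fset R}) : (zar_of A `|` zar_of B)%O =
  radical (ideal_add (ideal_gen [set` A]) (ideal_gen [set` B])) :> set R.
Proof. by rewrite [LHS]radical_addr //; apply: ideal_gen_is_ideal. Qed.

End Zariski.

Definition lattice_entails (d : Order.disp_t) (L : tbDistrLatticeType d)
    (A B : {fset L}) : Prop :=
  (\meet_(a <- A) a <= \join_(b <- B) b)%O.

Section Entailment.
Local Open Scope fset_scope.

Definition is_entailment (S : choiceType) (ent : {fset S} -> {fset S} -> Prop) :
    Prop :=
  [/\ forall a, ent [fset a] [fset a],
      forall A B A' B', ent A B -> A `<=` A' -> B `<=` B' -> ent A' B'
    & forall A B x, ent (x |` A) B -> ent A (x |` B) -> ent A B].

Definition ring_axioms (R : comPzRingType) (ent : {fset R} -> {fset R} -> Prop) :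
    Prop :=
  [/\ ent [fset 0] fset0,
      ent fset0 [fset 1],
      forall x y, ent [fset x; y] [fset (x * y)%R],
      forall x y, ent [fset (x * y)%R] [fset x]
    & forall x y, ent [fset (x + y)%R] [fset x; y]].

Definition ring_entails (R : comPzRingType) (A B : {fset R}) : Prop :=
  forall ent, is_entailment ent -> ring_axioms ent -> ent A B.

Lemma ring_entails_is_entailment (R : comPzRingType) :
  is_entailment (@ring_entails R).
Proof.
split=> [a ent [r _ _] _|A B A' B' AB sA sB ent e x|A B x AB BA ent e rx].
- exact: r.
- by case: (e) => _ m _; apply: m (AB _ e x) sA sB.
- by case: (e) => _ _ t; apply: t (AB _ e rx) (BA _ e rx).
Qed.

Lemma ring_entails_axioms (R : comPzRingType) : ring_axioms (@ring_entails R).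
Proof. by split=> [||x y|x y|x y] ent _ []. Qed.

(* x lists x_1, ..., x_l, so for k : 'I_l the term x k is x_(k+1). Hence for
   i : 'I_l.+1 the left-hand side receives x_(i+1) unless i = l (no such k),
   and the right-hand side receives x_i unless i = 0. *)
Definition entailment_chain (T : choiceType)
    (ent : {fset T} -> {fset T} -> Prop) (l : nat)
    (U J : 'I_l.+1 -> {fset T}) (x : 'I_l -> T) : Prop :=
  forall i : 'I_l.+1,
    ent ([fset x k | k : 'I_l & k == i :> nat] `|` U i)
        (J i `|` [fset x k | k : 'I_l & k.+1 == i :> nat]).

End Entailment.

(* u_0 (u_1 (... (u_l + j_l) ...) + j_1) + j_0; folding from 1 makes the
   innermost term u_l * 1 + j_l. *)
Definition nested_sum (R : comPzRingType) (l : nat) (u j : 'I_l.+1 -> R) : R :=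
  foldr (fun i v => u i * v + j i) 1 (enum 'I_l.+1).

(* Main.v *)
Require Import Defs.
From mathcomp Require Import all_boot all_order all_algebra finmap.
From mathcomp Require Import boolp classical_sets.
Local Open Scope ring_scope.

Set Implicit Arguments.
Unset Strict Implicit.
Unset Printing Implicit Defensive.

Import Order.TTheory GRing.Theory.

(** The three properties are linked in the circle nested equation => chain in
    [R] => chain in the Zariski lattice => nested equation.

    Nested equation => chain in [R]. Let [v_i] be the part of the nested
    expression that starts at level [i], so that [v_i = u_i v_(i+1) + j_i],
    where [v_0 = 0] is the equation and [v_(l+1) = 1] is the empty tail. Each
    of these recursions is by itself an entailment
    [v_(i+1), U_i |- J_i, v_i] ([ring_entails_link]): a product of elements of
    [U_i] follows from [U_i], and an element of the ideal of [J_i] implies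
    [J_i]. So [x_i := v_i] is a chain, its ends being absorbed by [0 |- ] and
    [ |- 1] ([entailment_chain_pad]).

    Chain in [R] => chain in [Zar R]. Pulling the lattice entailment back along
    [a |-> sqrt <a>] gives an entailment relation that satisfies the ring
    axioms, hence contains the least one ([ring_entails_tilde]); so
    [L_i := sqrt <x_i>] works.

    Chain in [Zar R] => nested equation. Let [N_i] be the set of all values of
    nested expressions starting at level [i]: [N_(l+1) = {1}] and
    [N_i = M(U_i) N_(i+1) + <J_i>]. The point is that [N_i] is closed under
    products ([nested_monoid_is_submonoid]), so that the exponents which come
    from radicals do no harm. With [L_0 = 0] and [L_(l+1) = R], every [N_i]
    meets [L_i], by descending induction ([nested_monoid_step]): if [v] lies in
    [N_(i+1)] and [L_(i+1)], and [p] is the product of [U_i], then [p v] lies in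
    [L_(i+1)] and in [sqrt <a>] for all [a] in [U_i], so some [(p v)^n] is
    [j + w] with [j] in [<J_i>] and [w] in [L_i]; and [w = p^n v^n - j] is again
    in [N_i]. At level 0 this yields a nilpotent element of [N_0], some power of
    which is [0] and lies in [N_0] too. *)

(** * Entailment relations and the padding of chains *)

Section EntailmentRelations.
Local Open Scope fset_scope.
Variables (T : choiceType) (ent : {fset T} -> {fset T} -> Prop).
Hypothesis entE : is_entailment ent.

Lemma entailment_mono A B A' B' :
  ent A B -> A `<=` A' -> B `<=` B' -> ent A' B'.
Proof. by case: entE => _ mono _; apply: mono. Qed.

Lemma entailment_cut x A B : ent A (x |` B) -> ent (x |` A) B -> ent A B.
Proof. by case: entE => _ _ cut Ax xB; apply: cut xB Ax. Qed.

Lemma entailment_trans x A B : ent A [fset x] -> ent [fset x] B -> ent A B.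
Proof.
move=> Ax xB; apply: (@entailment_cut x).
  by apply: entailment_mono Ax _ _ => //; rewrite fsub1set fset1U1.
by apply: entailment_mono xB _ _ => //; rewrite fsub1set fset1U1.
Qed.

(** A chain may be prolonged by a false term [b] at index 0 and a true term [t]
    at index [l + 1]. This turns the exceptional first and last conditions into
    instances of the general one, so that all later arguments are uniform in
    [i]. *)
Lemma entailment_chain_pad (b t : T) l (U J : 'I_l.+1 -> {fset T}) :
    ent [fset b] fset0 -> ent fset0 [fset t] ->
  (exists x, entailment_chain ent U J x) <->
  (exists y : nat -> T, [/\ y 0%N = b, y l.+1 = t &
     forall i : 'I_l.+1, ent (y i.+1 |` U i) (y i |` J i)]).
Proof.
move=> b0 t1; split=> [[x xP]|[y [y0 yl yP]]].
  pose y n := if n is k.+1 then oapp x t (insub k) else b.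
  exists y; split=> // [|i]; first by rewrite /y /= insubF ?ltnn.
  apply: entailment_mono (xP i) _ _; apply/fsubsetP=> z;
    rewrite !inE => /orP[]; try by move=> ->; rewrite orbT.
    by move=> /imfsetP[k /= /eqP ki ->]; rewrite /y -ki valK /= eqxx.
  by move=> /imfsetP[k /= /eqP ki ->]; rewrite /y -ki valK /= eqxx.
exists (fun k : 'I_l => y k.+1) => i.
set A := (X in X `|` U i); set B := (X in J i `|` X).
(* The term [y i.+1] is listed in [A] unless [i] is the last index, where it
   is [t] and can be cut against [ |- t]. *)
have yA : ent (A `|` U i) (y i |` J i).
  have [il|li] := ltnP i l.
    apply: entailment_mono (yP i) _ _ => //; apply: fsetSU; rewrite fsub1set.
    by apply/imfsetP; exists (Ordinal il); rewrite /= ?inE ?eqxx.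
  have il : i = l :> nat by apply/eqP; rewrite eqn_leq li -ltnS ltn_ord.
  apply: (@entailment_cut t).
    by apply: entailment_mono t1 _ _; rewrite ?fsub0set // fsub1set fset1U1.
  apply: entailment_mono (yP i) _ _ => //.
  by rewrite il yl; apply: fsetUS; apply: fsubsetUr.
(* Dually, [y i] is listed in [B] unless [i = 0], where it is [b]. *)
case: (posnP i) => [i0|i_gt0].
  apply: (@entailment_cut b).
    by apply: entailment_mono yA _ _ => //; rewrite i0 y0 fsetUS ?fsubsetUl.
  by apply: entailment_mono b0 _ _; rewrite ?fsub0set // fsub1set fset1U1.
apply: entailment_mono yA _ _ => //; rewrite fsetUC; apply: fsetUS.
rewrite fsub1set; apply/imfsetP.
have il : (i.-1 < l)%N by rewrite -ltnS prednK.
by exists (Ordinal il); rewrite /= ?inE ?prednK ?eqxx.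
Qed.

End EntailmentRelations.

(** * The entailment relation of a ring *)

Section RingEntailment.
Local Open Scope fset_scope.
Local Open Scope ring_scope.
Variable R : comPzRingType.
Implicit Types (A B : {fset R}) (x y m v : R).

Let entE := ring_entails_is_entailment R.

(** Together with [ring_entails_ideal], the half of the formal Nullstellensatz
    that derives entailments from algebraic identities: by the axioms,
    the consequences of [A] are closed under products and the elements implying
    [B] form an ideal. *)
Lemma ring_entails_monoid A m :
  monoid_gen [set` A]%classic m -> ring_entails A [fset m].
Proof.
have [_ one mul _ _] := ring_entails_axioms R; have [rfl _ _] := entE.
move=> Am; apply: (Am [set x | ring_entails A [fset x]]%classic); split; last first.
  by move=> a aA; apply: entailment_mono (rfl a) _ _; rewrite ?fsubset_refl ?fsub1set.
split=> [|x y Ax Ay]; first by apply: entailment_mono one _ _; rewrite ?fsub0set.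
apply: (entailment_cut entE (x := x)).
  by apply: entailment_mono Ax _ _ => //; rewrite fsub1set fset1U1.
apply: (entailment_cut entE (x := y)).
  by apply: entailment_mono Ay _ _; rewrite ?fsubsetUr // fsub1set fset1U1.
apply: entailment_mono (mul x y) _ _ => //.
by apply/fsubsetP=> z; rewrite !inE => /orP[]->; rewrite ?orbT.
Qed.

Lemma ring_entails_ideal B x :
  ideal_gen [set` B]%classic x -> ring_entails [fset x] B.
Proof.
have [zero _ _ fact add] := ring_entails_axioms R; have [rfl _ _] := entE.
move=> Bx; apply: (Bx [set y | ring_entails [fset y] B]%classic); split; last first.
  by move=> a aB; apply: entailment_mono (rfl a) _ _; rewrite ?fsubset_refl ?fsub1set.
split=> [|y z yB zB|a y yB].
- by apply: entailment_mono zero _ _; rewrite ?fsub0set.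
- apply: (entailment_cut entE (x := y)); last first.
    by apply: entailment_mono yB _ _ => //; rewrite fsub1set fset1U1.
  apply: (entailment_cut entE (x := z)); last first.
    by apply: entailment_mono zB _ _; rewrite ?fsubsetUr // fsub1set fset1U1.
  apply: entailment_mono (add y z) _ _ => //.
  by apply/fsubsetP=> w; rewrite !inE => /orP[]->; rewrite ?orbT.
- by rewrite mulrC; apply: entailment_trans (fact y a) yB.
Qed.

(** One level [u v + j] of a nested expression, read as an entailment: from [v]
    and [A] one gets [u v = (u v + j) + (- j)]; a sum entails the disjunction of
    its terms, and [- j] implies [B]. *)
Lemma ring_entails_link A B u j v :
    monoid_gen [set` A]%classic u -> ideal_gen [set` B]%classic j ->
  ring_entails (v |` A) ((u * v + j) |` B).
Proof.
move=> uA jB; have [_ _ mul _ add] := ring_entails_axioms R.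
have mono := entailment_mono entE.
apply: (entailment_cut entE (x := u)).
  by apply: mono (ring_entails_monoid uA) _ _; rewrite ?fsubsetUr // fsub1set fset1U1.
apply: (entailment_cut entE (x := u * v)).
  apply: mono (mul u v) _ _; last by rewrite fsub1set fset1U1.
  by apply/fsubsetP=> z; rewrite !inE => /orP[]->; rewrite ?orbT.
apply: (entailment_cut entE (x := - j)).
  have := add (u * v + j) (- j); rewrite addrK => uvj.
  apply: mono uvj _ _; first by rewrite fsub1set fset1U1.
  by apply/fsubsetP=> z; rewrite !inE => /orP[]->; rewrite ?orbT.
have [_ _ IM] := ideal_gen_is_ideal [set` B]%classic.
have NjB : ideal_gen [set` B]%classic (- j) by rewrite -mulN1r; apply: IM.
apply: mono (ring_entails_ideal NjB) _ _; last exact: fsubsetUr.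
by rewrite fsub1set fset1U1.
Qed.

End RingEntailment.

(** * The entailment relation of a distributive lattice *)

Section LatticeEntailment.
Local Open Scope fset_scope.
Variables (d : Order.disp_t) (L : tbDistrLatticeType d).
Implicit Types (A B : {fset L}) (x : L).

(** Only the cut rule has content, and it is the form that distributivity takes
    for entailments: [a = a /\ (x \/ b) = (a /\ x) \/ (a /\ b) <= b]. *)
Lemma lattice_entails_is_entailment : is_entailment (@lattice_entails d L).
Proof.
rewrite /lattice_entails; split=> [a|A B A' B' AB sA sB|A B x].
- by rewrite !big_seq_fset1.
- apply: le_trans (le_trans AB _).
    by apply/meetsP_seq=> a aA _; apply: meets_inf_seq => //; apply: (fsubsetP sA).
  by apply/joinsP_seq=> b bB _; apply: joins_sup_seq => //; apply: (fsubsetP sB).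
set a := (\meet_(a <- A) a)%O; set b := (\join_(b <- B) b)%O => xab axb.
have xa : (x `&` a <= b)%O.
  apply: le_trans xab; apply/meetsP_seq=> z; rewrite !inE => /orP[/eqP->|zA] _.
    exact: leIl.
  by apply: le_trans (leIr _ _) _; apply: meets_inf_seq.
have ax : (a <= x `|` b)%O.
  apply: le_trans axb _; apply/joinsP_seq=> z; rewrite !inE => /orP[/eqP->|zB] _.
    exact: leUl.
  by apply: le_trans (leUr _ _); apply: (joins_sup_seq id).
by rewrite -(meet_idPl ax) meetUr leUx meetC xa leIr.
Qed.

End LatticeEntailment.

(** * From the ring to its Zariski lattice *)

Section ZariskiEntailment.
Local Open Scope fset_scope.
Local Open Scope ring_scope.
Variable R : comPzRingType.
Implicit Types (A B : {fset R}) (a x : R) (L : Zar R).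

(** Turns order computations in the lattice into membership in a radical
    ideal; an inequality with a principal left-hand side only needs to be
    checked on the generator. *)
Lemma zar_tilde_le a L : (zar_tilde a <= L)%O <-> zar_set L a.
Proof.
split=> [/asboolP aL|La].
  apply: aL; apply: sub_radical; apply: sub_gen_smallest; exact: fset11.
apply/asboolP; rewrite -[zar_set L]zar_radical; apply: radical_sub.
apply: subset_trans (@sub_radical _ _).
apply: ideal_gen_sub; first exact: zar_is_ideal.
by move=> _ /fset1P->.
Qed.

Lemma mem_zar_tilde a : zar_set (zar_tilde a) a.
Proof. exact/zar_tilde_le. Qed.

Lemma zar_tilde0 : zar_tilde (0 : R) = \bot%O.
Proof.
apply/eqP; rewrite -lex0; apply/zar_tilde_le.
by have [] := zar_is_ideal (\bot : Zar R)%O.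
Qed.

Lemma zar_tilde1 : zar_tilde (1 : R) = \top%O.
Proof. by []. Qed.

(** [sqrt I /\ sqrt K = sqrt (I K)], and the product of two principal
    ideals is generated by the product of their generators. *)
Lemma zar_tildeM x y :
  (zar_tilde x `&` zar_tilde y <= zar_tilde (x * y))%O.
Proof.
apply/asboolP; rewrite zar_meet_of ideal_mul_gen; apply: radical_sub.
apply: ideal_gen_sub; first exact: (zar_is_ideal (zar_tilde (x * y))).
move=> _ /imfset2P[_ /fset1P-> [_ /fset1P-> ->]].
exact: mem_zar_tilde.
Qed.

Lemma zar_tildeD x y : (zar_tilde (x + y) <= zar_tilde x `|` zar_tilde y)%O.
Proof.
apply/zar_tilde_le; have [_ add _] := zar_is_ideal (zar_tilde x `|` zar_tilde y)%O.
by apply: add; apply/zar_tilde_le; [exact: leUl|exact: leUr].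
Qed.

Definition tilde_entails A B : Prop :=
  lattice_entails [fset zar_tilde a | a in A] [fset zar_tilde a | a in B].

(** Distinct elements of [A] may have the same radical and are then merged in
    the image; as meets and joins are idempotent, indexing by the elements
    themselves gives the same value. *)
Lemma tilde_entailsE A B : tilde_entails A B <->
  (\meet_(a <- A) zar_tilde a <= \join_(b <- B) zar_tilde b)%O.
Proof.
have -> : (\meet_(a <- A) zar_tilde a = \meet_(L <- [fset zar_tilde a | a in A]) L)%O.
  apply: le_anti; apply/andP; split; apply/meetsP_seq.
    by move=> _ /imfsetP[a aA ->] _; apply: meets_inf_seq.
  by move=> a aA _; apply: meets_inf_seq => //; apply: in_imfset.
have -> // : (\join_(a <- B) zar_tilde a = \join_(L <- [fset zar_tilde a | a in B]) L)%O.
apply: le_anti; apply/andP; split; apply/joinsP_seq.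
  move=> b bB _; apply: (joins_sup_seq id) => //; exact: in_imfset.
by move=> _ /imfsetP[b bB ->] _; apply: joins_sup_seq.
Qed.

Lemma tilde_entails_is_entailment : is_entailment tilde_entails.
Proof.
have [rfl mono cut] := lattice_entails_is_entailment (Zar R).
split=> [a|A B A' B' AB sA sB|A B x]; rewrite /tilde_entails.
- by apply/tilde_entailsE; rewrite !big_seq_fset1.
- by apply: mono AB _ _; apply: subset_imfset; apply/fsubsetP.
- by rewrite !imfsetU1; apply: cut.
Qed.

Lemma tilde_entails_axioms : ring_axioms tilde_entails.
Proof.
have mem : forall A a, a \in A -> (zar_tilde a <= \join_(b <- A) zar_tilde b)%O.
  by move=> A a aA; apply: joins_sup_seq.
split=> [||x y|x y|x y]; apply/tilde_entailsE; rewrite ?big_seq_fset1.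
- by rewrite zar_tilde0.
- by rewrite zar_tilde1 lex1.
- apply: le_trans (zar_tildeM x y).
  by rewrite lexI; apply/andP; split; apply: meets_inf_seq; rewrite // !inE eqxx ?orbT.
- apply/zar_tilde_le; rewrite mulrC; have [_ _ mul] := zar_is_ideal (zar_tilde x).
  exact/mul/mem_zar_tilde.
- apply: le_trans (zar_tildeD x y) _.
  by rewrite leUx; apply/andP; split; apply: mem; rewrite !inE eqxx ?orbT.
Qed.

Lemma ring_entails_tilde A B : ring_entails A B -> tilde_entails A B.
Proof.
by apply; [exact: tilde_entails_is_entailment|exact: tilde_entails_axioms].
Qed.

Lemma zar_meets_mem (r : seq (Zar R)) x :
  (forall L, L \in r -> zar_set L x) -> zar_set (\meet_(L <- r) L)%O x.
Proof.
by move=> xr; apply/zar_tilde_le/meetsP_seq => L Lr _; apply/zar_tilde_le/xr.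
Qed.

(** The universal property of joins, for an upper bound that is only known as
    the radical of an ideal. With [I] the sum of [<J_i>] and [L], membership in
    [radical I] splits a power of the element along this sum. *)
Lemma zar_joins_sub (r : seq (Zar R)) (I : set R) : is_ideal I ->
    (forall L, L \in r -> zar_set L `<=` radical I)%classic ->
  (zar_set (\join_(L <- r) L)%O `<=` radical I)%classic.
Proof.
move=> Iid rI; rewrite big_seq; elim/big_ind: _ => //.
  apply: radical_sub; apply: ideal_gen_sub => //; exact: radical_is_ideal.
move=> L M LI MI; apply: radical_sub => _ [x Lx [y My <-]].
by have [_ add _] := radical_is_ideal Iid; apply: add; [exact: LI|exact: MI].
Qed.

End ZariskiEntailment.

(** * Nested expressions and the collapse of a chain *)

Section NestedSums.
Variables (R : comPzRingType) (l : nat) (J U : 'I_l.+1 -> {fset R}).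
Implicit Types (i : 'I_l.+1) (s : seq 'I_l.+1).
Local Open Scope classical_set_scope.

Let I i := ideal_gen [set` J i].
Let M i := monoid_gen [set` U i].

Lemma monoid_gen_is_submonoid (G : set R) : is_submonoid (monoid_gen G).
Proof.
split=> [|x y Gx Gy] S SG; have [[S1 SM] _] := SG => //.
by apply: SM; [exact: Gx|exact: Gy].
Qed.

Lemma submonoid_exp (S : set R) x n : is_submonoid S -> S x -> S (x ^+ n).
Proof.
by move=> [S1 SM] Sx; elim: n => [|n Sn]; rewrite ?expr0 // exprS; apply: SM.
Qed.

(** The values of nested expressions over the levels listed in [s]. A list of
    levels, rather than a starting index, follows the fold that defines the
    nested sum. *)
Fixpoint nested_monoid s : set R :=
  if s is i :: s' then
    [set z | exists u v j, [/\ M i u, nested_monoid s' v, I i j & z = u * v + j]]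
  else [set 1].

(** [(u v + j) (u' v' + j') = u u' v v' + (u v j' + (u' v' + j') j)]: the
    cross terms all lie in the ideal. This absorbs the exponents produced by
    radicals. *)
Lemma nested_monoid_is_submonoid s : is_submonoid (nested_monoid s).
Proof.
elim: s => [|i s [S1 SM]] /=; first by split=> // x y -> ->; rewrite mulr1.
have [M1 MM] := monoid_gen_is_submonoid [set` U i].
have [I0 ID IM] := ideal_gen_is_ideal [set` J i].
split=> [|_ _ [u [v [j [uM vS jI ->]]]] [u' [v' [j' [uM' vS' jI' ->]]]]].
  by exists 1, 1, 0; rewrite mulr1 addr0.
exists (u * u'), (v * v'), (u * v * j' + (u' * v' + j') * j).
split; [exact: MM|exact: SM|by apply: ID; apply: IM|].
rewrite mulrDl !mulrDr mulrACA addrA mulrDl [j * (u' * v')]mulrC [j * j']mulrC.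
by rewrite !addrA.
Qed.

(** Collects the witnesses of the successive levels into two functions. As the
    levels are distinct, redefining the functions at the head level does not
    disturb the value of the tail. *)
Lemma nested_monoid_foldr s z : uniq s -> nested_monoid s z ->
  exists j u : 'I_l.+1 -> R, [/\ forall i, I i (j i), forall i, M i (u i)
    & foldr (fun i v => u i * v + j i) 1 s = z].
Proof.
elim: s z => [|i s IHs] z /=.
  move=> _ ->; exists (fun=> 0), (fun=> 1).
  split=> // i; first by have [] := ideal_gen_is_ideal [set` J i].
  by have [] := monoid_gen_is_submonoid [set` U i].
move=> /andP[nis /IHs{}IHs] [u0 [v [j0 [Mu /IHs[j [u [jI uM <-]]] Ij ->]]]].
exists (fun k => if k == i then j0 else j k), (fun k => if k == i then u0 else u k).
split=> [k|k|]; try by case: eqP => // ->.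
rewrite eqxx; congr (_ * _ + _); elim: s nis {IHs} => //= k s IHs.
by rewrite inE negb_or eq_sym => /andP[/negPf-> /IHs->].
Qed.

Lemma drop_enum_ord i :
  drop i (enum 'I_l.+1) = i :: drop i.+1 (enum 'I_l.+1).
Proof.
by rewrite (drop_nth i) ?size_enum_ord ?ltn_ord // nth_ord_enum.
Qed.

(** Descending one level. The exponent [n] which places [(p v) ^+ n] in
    [<J_i> + L] is distributed over [p] and [v], which both range over
    submonoids. *)
Lemma nested_monoid_step i (L L' : Zar R) v :
    lattice_entails (L' |` [fset zar_tilde a | a in U i])%fset
                    (L |` [fset zar_tilde a | a in J i])%fset ->
    nested_monoid (drop i.+1 (enum 'I_l.+1)) v -> zar_set L' v ->
  exists2 z, nested_monoid (drop i (enum 'I_l.+1)) z & zar_set L z.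
Proof.
move=> /asboolP LL' Sv Lv; rewrite drop_enum_ord.
pose p := \prod_(a <- U i) a.
have [M1 MM] := monoid_gen_is_submonoid [set` U i].
have pM : M i p.
  rewrite /p big_seq; elim/big_ind: _ => // a aU.
  exact: sub_gen_smallest.
have Iid := ideal_gen_is_ideal [set` J i]; have Lid := zar_is_ideal L.
have [[I0 ID IM] [L0 LD LM]] := (Iid, Lid).
have pv : radical (ideal_add (I i) L) (p * v).
  apply: (zar_joins_sub (ideal_add_is_ideal Iid Lid)); last first.
    apply: LL'; apply: zar_meets_mem => K; rewrite !inE => /orP[/eqP->|].
      by have [_ _ mul] := zar_is_ideal L'; apply: mul.
    move=> /imfsetP[a aU ->]; rewrite /p (big_fsetD1 a) //= -mulrA mulrC.
    have [_ _ mul] := zar_is_ideal (zar_tilde a).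
    exact/mul/mem_zar_tilde.
  move=> K; rewrite !inE => /orP[/eqP->|/imfsetP[a aJ ->]].
    by move=> x Lx; apply: sub_radical; exists 0 => //; exists x; rewrite ?add0r.
  apply: radical_sub; apply: ideal_gen_sub.
    exact/radical_is_ideal/ideal_add_is_ideal.
  move=> _ /fset1P->; apply: sub_radical; exists a; first exact: sub_gen_smallest.
  by exists 0; rewrite ?addr0.
have [n [j jI [w Lw jw]]] := pv.
exists w => //; exists (p ^+ n), (v ^+ n), (- j); split.
- exact: submonoid_exp (monoid_gen_is_submonoid _) pM.
- exact: submonoid_exp (nested_monoid_is_submonoid _) Sv.
- by rewrite -mulN1r; apply: IM.
- by rewrite -exprMn -jw addrC addKr.
Qed.

Lemma zar_chain_collapse (Y : nat -> Zar R) :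
    Y 0%N = \bot%O -> Y l.+1 = \top%O ->
    (forall i, lattice_entails (Y i.+1 |` [fset zar_tilde a | a in U i])%fset
                               (Y i |` [fset zar_tilde a | a in J i])%fset) ->
  nested_monoid (enum 'I_l.+1) 0.
Proof.
move=> Y0 Yl YP.
(* Starts from [1], the value of the empty nested expression, which belongs to
   the top element; [k] counts the levels already crossed. *)
have descent k : (k <= l.+1)%N ->
    exists2 z, nested_monoid (drop (l.+1 - k) (enum 'I_l.+1)) z
             & zar_set (Y (l.+1 - k)%N) z.
  elim: k => [|k IHk] kl.
    exists 1; first by rewrite subn0 drop_oversize // size_enum_ord.
    by rewrite subn0 Yl -zar_tilde1; exact: mem_zar_tilde.
  have il : (l.+1 - k.+1 < l.+1)%N by rewrite ltn_subrL.
  have ik : (l.+1 - k)%N = (Ordinal il).+1 by rewrite /= -subSn.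
  have [v] := IHk (ltnW kl); rewrite ik.
  exact: nested_monoid_step (YP (Ordinal il)).
have [z] := descent _ (leqnn _); rewrite subnn drop0 Y0 => Sz [n].
(* The bottom element is the radical of the ideal generated by the empty set,
   that is of the zero ideal: a power of [z] vanishes. *)
have zero_ideal : is_ideal [set (0 : R)].
  by split=> // [x y -> ->|a x ->]; rewrite ?addr0 ?mulr0.
move=> zn; have <- : z ^+ n = 0 by apply: (ideal_gen_sub zero_ideal _ zn).
exact: submonoid_exp (nested_monoid_is_submonoid _) Sz.
Qed.

End NestedSums.

Theorem theorem3p5 (R : comPzRingType) (l : nat) (J U : 'I_l.+1 -> {fset R}) :
  [<-> exists j u : 'I_l.+1 -> R,
         [/\ forall i, ideal_gen [set` J i]%classic (j i),
             forall i, monoid_gen [set` U i]%classic (u i)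
           & nested_sum u j = 0];
       exists L : 'I_l -> Zar R,
         entailment_chain (@lattice_entails _ (Zar R))
           (fun i => [fset zar_tilde a | a in U i]%fset)
           (fun i => [fset zar_tilde a | a in J i]%fset) L;
       exists x : 'I_l -> R, entailment_chain (@ring_entails R) U J x].
Proof.
have [zero one _ _ _] := ring_entails_axioms R.
have lat0 : lattice_entails [fset (\bot : Zar R)%O]%fset fset0.
  by rewrite /lattice_entails big_seq_fset1 le0x.
have lat1 : lattice_entails fset0 [fset (\top : Zar R)%O]%fset.
  by rewrite /lattice_entails big_seq_fset1 lex1.
have ringP := entailment_chain_pad (ring_entails_is_entailment R) U J zero one.
have latP := entailment_chain_pad (lattice_entails_is_entailment (Zar R))
  (fun i => [fset zar_tilde a | a in U i]%fset)
  (fun i => [fset zar_tilde a | a in J i]%fset) lat0 lat1.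
have nested_to_ring : (exists j u : 'I_l.+1 -> R,
      [/\ forall i, ideal_gen [set` J i]%classic (j i),
          forall i, monoid_gen [set` U i]%classic (u i) & nested_sum u j = 0]) ->
    exists x : 'I_l -> R, entailment_chain (@ring_entails R) U J x.
  move=> [j [u [jJ uU uj0]]]; apply/ringP.
  exists (fun k => foldr (fun i v => u i * v + j i) 1 (drop k (enum 'I_l.+1))).
  split=> [||i]; first by rewrite drop0.
    by rewrite drop_oversize // size_enum_ord.
  by rewrite [drop i _]drop_enum_ord /=; apply: ring_entails_link.
have ring_to_lattice : (exists x : 'I_l -> R,
      entailment_chain (@ring_entails R) U J x) ->
    exists L : 'I_l -> Zar R,
      entailment_chain (@lattice_entails _ (Zar R))
        (fun i => [fset zar_tilde a | a in U i]%fset)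
        (fun i => [fset zar_tilde a | a in J i]%fset) L.
  move=> /ringP[y [y0 yl yP]]; apply/latP; exists (fun k => zar_tilde (y k)).
  split=> [||i]; rewrite ?y0 ?yl ?zar_tilde0 //.
  by rewrite -!imfsetU1; exact: ring_entails_tilde.
have lattice_to_nested : (exists L : 'I_l -> Zar R,
      entailment_chain (@lattice_entails _ (Zar R))
        (fun i => [fset zar_tilde a | a in U i]%fset)
        (fun i => [fset zar_tilde a | a in J i]%fset) L) ->
    exists j u : 'I_l.+1 -> R,
      [/\ forall i, ideal_gen [set` J i]%classic (j i),
          forall i, monoid_gen [set` U i]%classic (u i) & nested_sum u j = 0].
  move=> /latP[Y [Y0 Yl YP]].
  exact: nested_monoid_foldr (enum_uniq _) (zar_chain_collapse Y0 Yl YP).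
tfae.
- by move=> /nested_to_ring/ring_to_lattice.
- by move=> /lattice_to_nested/nested_to_ring.
- by move=> /ring_to_lattice/lattice_to_nested.
Qed.
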